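(* Assume that $\varepsilon$ is a standard Gaussian vector in $\mathbb{R}^n$ and that there is $c\in(0,1)$, not depending on $n$, such that $$c\,\rho^2(P_n)\dim(S_m)\le\mathrm{Tr}({}^tP_n\pi_mP_n)\quad\text{for all }m\in\mathcal{M}.$$ Let $A\ge0$ be finite and such that $$\sup_{d\in\mathbb{N}:N_d>0}\frac{\log N_d}{d}\le A,$$ i.e. $\log N_d\le Ad$ for every $d\in\mathbb{N}$ with $N_d>0$ (in particular $N_0\le1$). Let $L,\theta,\omega$ be positive numbers satisfying $$L\ge\frac{2(1+\theta)^3}{c\theta^2}(A+\omega).$$ Then the estimator $\tilde s=\hat s_{\hat m}$ obtained with the penalty function $$\mathrm{pen}(m)=(1+\theta+L)\frac{\mathrm{Tr}({}^tP_n\pi_mP_n)}{n}\sigma^2$$ satisfies $$\mathbb{E}\left[\|s-\tilde s\|_n^2\right]\le C\inf_{m\in\mathcal{M}}\left\{\|s-s_m\|_n^2+(L\vee1)\frac{\mathrm{Tr}({}^tP_n\pi_mP_n)\vee(c\rho^2(P_n))}{n}\sigma^2\right\},$$ where $C>1$ depends only on $\theta$, $\omega$ and $c$.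
   Context: For $x\in\mathbb{R}^n$: $\|x\|_n^2=\frac1n\sum_{i=1}^nx_i^2$. For a real $n\times n$ matrix $A$, $\rho(A)=\sup_{x\ne0}\|Ax\|_n/\|x\|_n$ is the spectral norm, and ${}^tA$ is the transpose; $a\vee b=\max(a,b)$. One observes $Y=s+\sigma P_n\varepsilon\in\mathbb{R}^n$, where $P_n$ is a known real $n\times n$ matrix (not necessarily invertible), $s\in\mathrm{Im}(P_n)$ is unknown and deterministic, $\sigma>0$ is known, and $\varepsilon$ is the noise vector. $\{S_m,\ m\in\mathcal{M}\}$ is a finite or countable collection of linear subspaces of $\mathrm{Im}(P_n)$; $\pi_m$ is the orthogonal projection onto $S_m$; $s_m=\pi_ms$; $\hat s_m=\pi_mY$. For $d\in\mathbb{N}$ (including $d=0$), $N_d$ is the number of $m\in\mathcal{M}$ with $\dim(S_m)=d$. Given a penalty function $\mathrm{pen}:\mathcal{M}\to\mathbb{R}_+$, $\hat m$ is any minimizer over $m\in\mathcal{M}$ of $\|Y-\hat s_m\|_n^2+\mathrm{pen}(m)$, and $\tilde s=\hat s_{\hat m}$. *)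

(* Defs.v *)
From HB Require Import structures.
From mathcomp Require Import all_boot all_order all_algebra.
From mathcomp Require Import all_classical all_reals all_analysis.

Set Implicit Arguments.
Unset Strict Implicit.
Unset Printing Implicit Defensive.

Import Order.TTheory GRing.Theory Num.Theory.

Local Open Scope classical_set_scope.
Local Open Scope ring_scope.

(* Vectors of R^n are columns, and a matrix P acts by x |-> P *m x. *)

Section Euclidean.
Context {R : realType} {n : nat}.

Definition normn (x : 'cV[R]_n) : R :=
  Num.sqrt (n%:R^-1 * \sum_(i < n) x i 0 ^+ 2).

Definition spectral_norm (A : 'M[R]_n) : R :=
  sup [set normn (A *m x) / normn x | x in [set x : 'cV[R]_n | x != 0]].

Definition matrix_image (P : 'M[R]_n) : {vspace 'cV[R]_n} :=
  limg (linfun (mulmx P : 'cV[R]_n -> 'cV[R]_n)).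

Definition is_orthogonal_projection (S : {vspace 'cV[R]_n}) (p : 'M[R]_n) :=
  forall x : 'cV[R]_n, p *m x \in S /\
    forall y, y \in S -> y^T *m (x - p *m x) = 0.

End Euclidean.

Section Probability.
Context {d : measure_display} {T : measurableType d} {R : realType}.
Context {P : probability T R}.

(* Product rule over the whole (finite) family; the rule for a subfamily is
   the case B i = setT for the indices i outside of it. *)
Definition mutually_independent {n : nat} (X : 'I_n -> {RV P >-> R}) :=
  forall B : 'I_n -> set R, (forall i, measurable (B i)) ->
    P (\bigcap_(i in [set: 'I_n]) X i @^-1` B i) =
    (\prod_(i < n) P (X i @^-1` B i))%E.

Definition standard_gaussian {n : nat} (X : 'I_n -> {RV P >-> R}) :=
  mutually_independent X /\
  forall i (B : set R), measurable B ->
    distribution P (X i) B = normal_prob 0 1 B.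

Definition observation {n : nat} (s : 'cV[R]_n) (sigma : R) (Pn : 'M[R]_n)
    (eps : 'I_n -> {RV P >-> R}) (w : T) : 'cV[R]_n :=
  s + sigma *: (Pn *m \col_i eps i w).

End Probability.

Section ModelSelection.
Context {R : realType} {n : nat} {M : countType}.

(* The number of models of dimension k, +oo if there are infinitely many. *)
Definition nb_models (S : M -> {vspace 'cV[R]_n}) (k : nat) : \bar R :=
  counting [set m | \dim (S m) = k].

(* [lne] is the logarithm on the extended reals, with lne +oo = +oo. *)
Definition log_nb_models_le (S : M -> {vspace 'cV[R]_n}) (A : R) :=
  forall k : nat, (0 < nb_models S k)%E ->
    (lne (nb_models S k) <= (A * k%:R)%:E)%E.

Definition penalized_criterion (proj : M -> 'M[R]_n) (pen : M -> R)
    (y : 'cV[R]_n) (m : M) : R :=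
  normn (y - proj m *m y) ^+ 2 + pen m.

Definition is_minimizer (f : M -> R) (m0 : M) := forall m, f m0 <= f m.

End ModelSelection.

(* Main.v *)
Require Import Defs.
From HB Require Import structures.
From mathcomp Require Import all_boot all_order all_algebra.
From mathcomp Require Import all_classical all_reals all_analysis.
From mathcomp Require Import finmap measurable_realfun ring lra.

(* Write x = s - pi_m s, xi = sigma P_n eps, and let u_m be x normalised.
   Comparing the criterion at the selected model with its value at any m bounds
   kappa |s - stilde|^2 by the bias and penalty of m plus the excess over the
   penalty, at both models, of the energy
     Z_m = (1 + kappa) |pi_m xi|^2 + <u_m, xi>^2 / (1 - kappa).
   Z_m is a Gaussian quadratic form, and for vectors v_j with
   sum_j v_j v_j^T <= 1 - delta one has
     E exp(sum_j <v_j, eps>^2 / 2) <= exp(sum_j |v_j|^2 / (2 delta)).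
   Hence one exponential moment of each Z_m is at most 1 once its mean and a
   margin are subtracted; the factor exp(- (A + omega) dim S_m) left over from
   the penalty makes the sum over all models at most 1 / (1 - exp(- omega)),
   and that sum dominates the excess of every model simultaneously. *)

Set Implicit Arguments.
Unset Strict Implicit.
Unset Printing Implicit Defensive.

Import Order.TTheory GRing.Theory Num.Theory.

Local Open Scope classical_set_scope.
Local Open Scope ring_scope.

(** * Transfer of integrals along a weighted map *)

Section WeightedPushforward.
Local Open Scope ereal_scope.
Context d d' (T : measurableType d) (T' : measurableType d') (R : realType).
Variables (mu : {measure set T -> \bar R}) (nu : {measure set T' -> \bar R}).
Variables (X : T -> T') (G : T -> R) (a : R).
Hypotheses (mX : measurable_fun setT X) (mG : measurable_fun setT G).
Hypotheses (G0 : forall x, (0 <= G x)%R) (a0 : (0 <= a)%R).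
Hypothesis GX : forall B, measurable B ->
  \int[mu]_x (G x * \1_B (X x))%:E = a%:E * nu B.

Import HBNNSimple.

Lemma integral_weighted_nnsfun (h : {nnsfun T' >-> R}) :
  \int[mu]_x (G x * h (X x))%:E = a%:E * \int[nu]_y (h y)%:E.
Proof.
have mI r : measurable_fun setT (fun x => G x * \1_(h @^-1` [set r]) (X x))%R.
  apply: measurable_funM => //; apply: measurableT_comp => //.
have I0 r x : 0 <= (r * (G x * \1_(h @^-1` [set r]) (X x)))%:E.
  by rewrite mulrCA EFinM mule_ge0 ?lee_fin// -lee_fin EFinM nnfun_muleindic_ge0.
have E x : (G x * h (X x))%:E = \sum_(r \in range h)
    (r * (G x * \1_(h @^-1` [set r]) (X x)))%:E.
  rewrite fimfunE fsumEFin//; congr (_%:E).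
  rewrite !fsbig_finite//= mulr_sumr; apply: eq_bigr => r _.
  by rewrite mulrCA.
under eq_integral do rewrite E.
rewrite ge0_integral_fsum//; last first.
  by move=> r; apply/measurable_EFinP; exact: measurable_funM.
rewrite integralT_nnsfun sintegralE ge0_mule_fsumr; last first.
  exact: nnsfun_mulemu_ge0.
apply: eq_fsbigr => r /set_mem [y _ <-].
under eq_integral do rewrite EFinM.
rewrite ge0_integralZl//.
- by rewrite GX// muleCA.
- exact/measurable_EFinP.
- by move=> x _; rewrite lee_fin mulr_ge0.
- by rewrite lee_fin.
Qed.

(** [GX] is the case of indicators; simple functions follow by linearity and general [f] by monotone
    convergence along [nnsfun_approx]. With [X] the identity and [G] a density this is integration
    against a density; with [G] a product of other factors it isolates one coordinate of an
    independent family. *)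
Lemma integral_weighted (f : T' -> R) :
  measurable_fun setT f -> (forall y, 0 <= f y)%R ->
  \int[mu]_x (G x * f (X x))%:E = a%:E * \int[nu]_y (f y)%:E.
Proof.
move=> mf f0.
have mfE : measurable_fun setT (EFin \o f) by exact/measurable_EFinP.
pose h := nnsfun_approx measurableT mfE.
have hf y : (EFin \o h ^~ y) @ \oo --> (f y)%:E.
  by apply: (cvg_nnsfun_approx measurableT mfE) => // z _; rewrite lee_fin.
have hnd y m n : (m <= n)%N -> (h m y <= h n y)%R.
  by move=> mn; exact/lefP/nd_nnsfun_approx.
have intf : \int[nu]_y (f y)%:E = limn (fun n => \int[nu]_y (h n y)%:E).
  rewrite -monotone_convergence//.
  - by apply: eq_integral => y _; apply/esym/cvg_lim => //; exact: hf.
  - by move=> n; exact/measurable_EFinP.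
  - by move=> n y _; rewrite lee_fin.
  - by move=> y _ m n mn; rewrite lee_fin hnd.
have cf : cvgn (fun n => \int[nu]_y (h n y)%:E).
  apply: ereal_nondecreasing_is_cvgn => m n mn; apply: ge0_le_integral => //.
  - by move=> y _; rewrite lee_fin.
  - by apply/measurable_EFinP.
  - by apply/measurable_EFinP.
  - by move=> y _; rewrite lee_fin hnd.
transitivity (limn (fun n => \int[mu]_x (G x * h n (X x))%:E)).
  rewrite -monotone_convergence//.
  - apply: eq_integral => x _; apply/esym/cvg_lim => //.
    under eq_fun do rewrite EFinM.
    rewrite EFinM; apply: cvgeZl => //; exact: hf.
  - move=> n; apply/measurable_EFinP; apply: measurable_funM => //.
    exact: measurableT_comp.
  - by move=> n x _; rewrite lee_fin mulr_ge0.
  - by move=> x _ m n mn; rewrite lee_fin ler_wpM2l// hnd.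
rewrite intf; under eq_fun do rewrite integral_weighted_nnsfun.
by rewrite limeMl.
Qed.

End WeightedPushforward.

(** * Expectations of products of independent variables *)

Section IndependentProduct.
Local Open Scope ereal_scope.
Context d (T : measurableType d) (R : realType) (P : probability T R).
Context (n : nat) (X : 'I_n -> {RV P >-> R}).
Hypothesis indX : mutually_independent X.

(** Induction on the number [k] of leading coordinates whose [h i] may be arbitrary, the remaining
    ones being indicators. At [k = 0] the claim is independence itself; at [k = n] it is the full
    product rule. *)
Let indep_prod_aux (k : nat) (h : 'I_n -> R -> R) (e : 'I_n -> R) :
  (forall i, measurable_fun setT (h i)) -> (forall i x, 0 <= h i x)%R ->
  (forall i, \int[P]_w (h i (X i w))%:E = (e i)%:E) ->
  (forall i : 'I_n, (k <= i)%N -> exists2 B, measurable B & h i = \1_B) ->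
  \int[P]_w (\prod_i h i (X i w))%:E = (\prod_i e i)%:E.
Proof.
elim: k h e => [|k IH] h e mh h0 he hB.
  have /choice[B BP] i : exists B, measurable B /\ h i = \1_B.
    by have [B ? ?] := hB i isT; exists B.
  have mX i : measurable (X i @^-1` B i).
    by rewrite -[_ @^-1` _]setTI; apply: (measurable_funPT (X i)) => //; case: (BP i).
  rewrite -prodEFin -[RHS](_ : P (\bigcap_(i in [set: 'I_n]) X i @^-1` B i) = _).
    rewrite -[X in P X]setIT -integral_indic//; last first.
      by apply: fin_bigcap_measurable => // i _; exact: mX.
    apply: eq_integral => w _; congr (_%:E).
    have [allB|] := pselect (forall i, B i (X i w)).
      rewrite indicE mem_set; last by move=> i _; exact: allB.
      by apply: big1 => i _; rewrite (BP i).2 indicE mem_set.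
    move=> /existsNP[i Bi]; rewrite indicE memNset; last by move=> /(_ i Logic.I).
    by rewrite (bigD1 i)//= (BP i).2 indicE memNset// mul0r.
  rewrite indX; last by move=> i; case: (BP i).
  apply: eq_bigr => i _; rewrite -he.
  rewrite -[X in P X]setIT -integral_indic//.
  by apply: eq_integral => w _; rewrite (BP i).2.
have [kn|nk] := ltnP k n; last first.
  apply: (IH h) => // i ki; apply: hB.
  by have := leq_trans (ltn_ord i) (leq_trans nk ki); rewrite ltnn.
(* Coordinate [k] is freed by [integral_weighted], with the product [G] of the other factors as
   weight: its hypothesis on indicators replaces [h i0] by [\1_B], and this case is the induction
   hypothesis. *)
pose i0 := Ordinal kn.
have e0 i : (0 <= e i)%R.
  by rewrite -lee_fin -he; apply: integral_ge0 => w _; rewrite lee_fin.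
pose G w := (\prod_(i | i != i0) h i (X i w))%R.
have mG : measurable_fun setT G.
  rewrite /G; under eq_fun do rewrite -big_filter.
  by apply: measurable_prod => i _; apply: measurableT_comp.
transitivity (\int[P]_w (G w * h i0 (X i0 w))%:E).
  by apply: eq_integral => w _; rewrite (bigD1 i0)//= mulrC.
rewrite (@integral_weighted _ _ _ _ _ P (distribution P (X i0)) _ _
  (\prod_(i | i != i0) e i)%R) => //.
- rewrite ge0_integral_distribution; last 2 first.
  + exact/measurable_EFinP.
  + by move=> y; rewrite lee_fin.
  by rewrite he -EFinM [in RHS](bigD1 i0)//= mulrC.
- by move=> w; rewrite /G prodr_ge0.
- move=> B mB.
  pose h' i := if i == i0 then \1_B else h i.
  pose e' i := if i == i0 then fine (distribution P (X i0) B) else e i.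
  have mX : measurable (X i0 @^-1` B).
    by rewrite -[_ @^-1` _]setTI; exact: (measurable_funPT (X i0)).
  transitivity (\int[P]_w (\prod_i h' i (X i w))%:E).
    apply: eq_integral => w _; rewrite [in RHS](bigD1 i0)//= /h' eqxx mulrC.
    by congr (_ * _)%:E; apply: eq_bigr => i /negPf ->.
  rewrite (IH h' e').
  + rewrite (bigD1 i0)//= /e' eqxx mulrC EFinM fineK ?fin_num_measure//.
    by congr (_%:E * _); apply: eq_bigr => i /negPf ->.
  + by rewrite /h' => i; case: eqP => _.
  + by rewrite /h' => i x; case: eqP => _; rewrite // indicE.
  + rewrite /h' /e' => i; case: eqP => [->|_]; last exact: he.
    rewrite fineK ?fin_num_measure// /distribution /pushforward.
    by rewrite -[X in P X]setIT -integral_indic.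
  + rewrite /h' => i ki; case: eqP => [_|ii0]; first by exists B.
    apply: hB; rewrite ltn_neqAle ki andbT; apply/eqP => ki'.
    by apply: ii0; apply/val_inj.
Qed.

Lemma integral_prod_independent (h : 'I_n -> R -> R) (e : 'I_n -> R) :
  (forall i, measurable_fun setT (h i)) -> (forall i x, 0 <= h i x)%R ->
  (forall i, \int[P]_w (h i (X i w))%:E = (e i)%:E) ->
  \int[P]_w (\prod_i h i (X i w))%:E = (\prod_i e i)%:E.
Proof.
move=> mh h0 he; apply: (@indep_prod_aux n h) => // i.
by move=> /(leq_trans (ltn_ord i)); rewrite ltnn.
Qed.

End IndependentProduct.

(** * Gaussian integrals on the line *)

Section GaussianIntegral.
Local Open Scope ereal_scope.
Context (R : realType).

Lemma integral_normal_prob (m s : R) (f : R -> R) :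
  measurable_fun setT f -> (forall y, 0 <= f y)%R ->
  \int[normal_prob m s]_x (f x)%:E =
  \int[lebesgue_measure]_x (normal_pdf m s x * f x)%:E.
Proof.
move=> mf f0.
rewrite (@integral_weighted _ _ _ _ _ lebesgue_measure (normal_prob m s) idfun
  (normal_pdf m s) 1%R)// ?mul1e//.
- exact: measurable_id.
- exact: measurable_normal_pdf.
- by move=> x; exact: normal_pdf_ge0.
- move=> B mB; rewrite mul1e [RHS]integral_mkcond.
  by apply: eq_integral => x _; rewrite epatch_indic EFinM.
Qed.

(** Completing the square: multiplied by exp(a g^2 / 2 + b g), the standard normal density is a
    constant times the normal density of mean b / (1 - a) and variance 1 / (1 - a). *)
Lemma integral_std_normal_exp_quadratic (a b : R) : (a < 1)%R ->
  \int[normal_prob (0:R) (1:R)]_g (expR (a * g ^+ 2 / 2 + b * g))%:E =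
  ((Num.sqrt (1 - a))^-1 * expR (b ^+ 2 / (1 - a) / 2))%:E.
Proof.
move=> a1; have a1' : (0 < 1 - a)%R by rewrite subr_gt0.
rewrite integral_normal_prob; last 2 first.
- apply: measurableT_comp => //=; apply: measurable_funD => //.
  by apply: measurable_funM => //; apply: measurable_funM.
- by move=> y; rewrite expR_ge0.
pose s := ((Num.sqrt (1 - a))^-1)%R.
have s2 : (s ^+ 2 = (1 - a)^-1)%R by rewrite exprVn sqr_sqrtr// ltW.
have s0 : s != 0%R by rewrite invr_eq0 gt_eqF// sqrtr_gt0.
have sge0 : (0 <= s)%R by rewrite invr_ge0 sqrtr_ge0.
pose C := (s * expR (b ^+ 2 / (1 - a) / 2))%R.
transitivity (\int[lebesgue_measure]_x (C%:E * (normal_pdf (b / (1 - a)) s x)%:E)).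
  apply: eq_integral => x _; rewrite !normal_pdfE ?oner_eq0//= -EFinM; congr (_%:E).
  rewrite /normal_peak /normal_fun /C.
  have -> : (Num.sqrt (s ^+ 2 * pi *+ 2) = s * Num.sqrt (1 ^+ 2 * pi *+ 2))%R.
    by rewrite -mulrnAr sqrtrM ?sqr_ge0// sqrtr_sqr ger0_norm// expr1n mul1r.
  rewrite invfM; set K := (Num.sqrt _)^-1%R.
  rewrite -[LHS]mulrA -expRD.
  have -> : (s * expR (b ^+ 2 / (1 - a) / 2) *
     (s^-1 * K * expR (- (x - b / (1 - a)) ^+ 2 / (s ^+ 2 *+ 2))) =
     K * (expR (b ^+ 2 / (1 - a) / 2) *
      expR (- (x - b / (1 - a)) ^+ 2 / (s ^+ 2 *+ 2))))%R.
    by field.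
  rewrite -expRD; congr (_ * expR _)%R; rewrite s2 expr1n.
  by field; rewrite gt_eqF.
rewrite ge0_integralZl//.
- by rewrite integral_normal_pdf mule1.
- by apply/measurable_EFinP; exact: measurable_normal_pdf.
- by move=> x _; rewrite lee_fin normal_pdf_ge0.
- by rewrite lee_fin mulr_ge0 ?expR_ge0.
Qed.

Lemma integral_std_normal_scale_exp_quadratic (k a b : R) :
  (0 <= k)%R -> (a < 1)%R ->
  \int[normal_prob (0:R) (1:R)]_g (k * expR (a * g ^+ 2 / 2 + b * g))%:E =
  (k * ((Num.sqrt (1 - a))^-1 * expR (b ^+ 2 / (1 - a) / 2)))%:E.
Proof.
move=> k0 a1; under eq_integral do rewrite EFinM.
rewrite ge0_integralZl ?lee_fin//.
- by rewrite integral_std_normal_exp_quadratic.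
- apply/measurable_EFinP; apply: measurableT_comp => //=.
  apply: measurable_funD => //.
  by apply: measurable_funM => //; apply: measurable_funM.
Qed.

End GaussianIntegral.

(* [distribution P X] and [normal_prob m s] live on measurable structures of R
   with the same measurable sets but different displays, hence the detour
   through [integral_weighted] with weight 1. *)
Lemma integral_normal_rv d (T : measurableType d) (R : realType)
    (P : probability T R) (X : {RV P >-> R}) (f : R -> R) (m s : R) :
  measurable_fun setT f -> (forall x, 0 <= f x) ->
  (forall B : set R, measurable B -> distribution P X B = normal_prob m s B) ->
  (\int[P]_w (f (X w))%:E = \int[normal_prob m s]_x (f x)%:E)%E.
Proof.
move=> mf f0 H.
have mX : measurable_fun setT (X : T -> measurableTypeR R).
  by move=> mD B mB; apply: (measurable_funPT X).
transitivity (\int[P]_w ((cst 1 w : R) * f (X w))%:E)%E.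
  by apply: eq_integral => w _; rewrite mul1r.
rewrite (@integral_weighted _ _ T (measurableTypeR R) R P (normal_prob m s) X
  (cst 1) 1 mX)// ?mul1e//.
move=> B mB; rewrite mul1e.
under eq_integral do rewrite mul1r.
transitivity (distribution P X B); last exact: H.
rewrite /distribution /pushforward -[X in P X]setIT -integral_indic//.
rewrite -[_ @^-1` _]setTI; exact: (measurable_funPT X).
Qed.

(** * Euclidean inner product *)

Section DotProduct.
Context {R : realType} {n : nat}.
Implicit Types (x y z : 'cV[R]_n) (A : 'M[R]_n) (k : R).

Definition dot x y : R := \sum_i x i 0 * y i 0.

Lemma dotE x y : x^T *m y = (dot x y)%:M.
Proof.
by apply/matrixP => i j; rewrite !ord1 !mxE; apply: eq_bigr => k _; rewrite mxE.
Qed.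

Lemma dotC x y : dot x y = dot y x.
Proof. by apply: eq_bigr => i _; rewrite mulrC. Qed.

Lemma dotDl x y z : dot (x + y) z = dot x z + dot y z.
Proof. by rewrite -big_split; apply: eq_bigr => i _; rewrite mxE mulrDl. Qed.

Lemma dotZl k x y : dot (k *: x) y = k * dot x y.
Proof. by rewrite mulr_sumr; apply: eq_bigr => i _; rewrite mxE mulrA. Qed.

Lemma dotNl x y : dot (- x) y = - dot x y.
Proof. by rewrite -scaleN1r dotZl mulN1r. Qed.

Lemma dotBl x y z : dot (x - y) z = dot x z - dot y z.
Proof. by rewrite dotDl dotNl. Qed.

Lemma dotDr x y z : dot z (x + y) = dot z x + dot z y.
Proof. by rewrite dotC dotDl !(dotC z). Qed.

Lemma dotZr k x y : dot x (k *: y) = k * dot x y.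
Proof. by rewrite dotC dotZl dotC. Qed.

Lemma dotNr x y : dot x (- y) = - dot x y.
Proof. by rewrite dotC dotNl dotC. Qed.

Lemma dotBr x y z : dot z (x - y) = dot z x - dot z y.
Proof. by rewrite dotDr dotNr. Qed.

Lemma dot0l x : dot 0 x = 0.
Proof. by rewrite -(scale0r 0) dotZl mul0r. Qed.

Lemma dot0r x : dot x 0 = 0.
Proof. by rewrite dotC dot0l. Qed.

Lemma dotMl A x y : dot (A *m x) y = dot x (A^T *m y).
Proof.
have : (dot (A *m x) y)%:M = (dot x (A^T *m y))%:M :> 'M[R]_1.
  by rewrite -!dotE trmx_mul mulmxA.
by move/matrixP => /(_ 0 0); rewrite !mxE.
Qed.

Lemma dot_rank1 x y z : dot z ((x *m y^T) *m z) = dot x z * dot y z.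
Proof.
have : (dot z ((x *m y^T) *m z))%:M = (dot x z * dot y z)%:M :> 'M[R]_1.
  by rewrite -dotE -mulmxA (dotE y z) mul_mx_scalar -scalemxAr dotE scale_scalar_mx
    (dotC z x) mulrC.
by move/matrixP => /(_ 0 0); rewrite !mxE.
Qed.

Lemma dot_ge0 x : 0 <= dot x x.
Proof. by apply: sumr_ge0 => i _; rewrite -expr2 sqr_ge0. Qed.

Lemma dot_eq0 x : dot x x = 0 -> x = 0.
Proof.
move=> /eqP; rewrite psumr_eq0 => [/allP x0|i _]; last by rewrite -expr2 sqr_ge0.
apply/matrixP => i j; rewrite ord1 mxE; apply/eqP.
by have := x0 i (mem_index_enum i); rewrite mulf_eq0 orbb.
Qed.

Lemma dot_cauchy_schwarz x y : dot x y ^+ 2 <= dot x x * dot y y.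
Proof.
have [y0|y0] := eqVneq (dot y y) 0.
  have -> : dot x y = 0 by rewrite (dot_eq0 y0) dot0r.
  by rewrite y0 mulr0 expr0n.
have ygt0 : 0 < dot y y by rewrite lt_neqAle eq_sym y0 dot_ge0.
(* This vector is |y|^2 times the component of x orthogonal to y. *)
have := dot_ge0 (dot y y *: x - dot x y *: y).
have -> : dot (dot y y *: x - dot x y *: y) (dot y y *: x - dot x y *: y) =
  dot y y * (dot x x * dot y y - dot x y ^+ 2).
  by rewrite !(dotBl, dotBr, dotZl, dotZr) (dotC y x); ring.
by rewrite pmulr_rge0// subr_ge0.
Qed.

End DotProduct.

(** * Exponential moments of Gaussian quadratic forms *)

Section GaussianChaos.
Context d (T : measurableType d) (R : realType) (P : probability T R).
Context (n : nat) (eps : 'I_n -> {RV P >-> R}).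

Let E w : 'cV[R]_n := \col_i eps i w.

Lemma measurable_dot_eps (v : 'cV[R]_n) : measurable_fun setT (fun w => dot v (E w)).
Proof.
rewrite /dot; apply: measurable_sum => i.
by under eq_fun do rewrite mxE; exact: measurable_funM.
Qed.

Hypothesis geps : standard_gaussian eps.

Lemma gaussian_linear_mgf (t : 'cV[R]_n) :
  (\int[P]_w (expR (dot t (E w)))%:E = (expR (dot t t / 2))%:E)%E.
Proof.
have := @integral_prod_independent _ _ _ P _ eps geps.1
  (fun i x => expR (t i 0 * x)) (fun i => expR (t i 0 ^+ 2 / 2)).
have -> : (\prod_i expR (t i 0 ^+ 2 / 2))%R = expR (dot t t / 2).
  by rewrite -expR_sum mulr_suml.
move=> <-.
- apply: eq_integral => w _; rewrite -expR_sum.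
  by congr (expR _)%:E; apply: eq_bigr => i _; rewrite mxE.
- by move=> i; apply: measurableT_comp => //; exact: measurable_funM.
- by move=> i x; exact: expR_ge0.
move=> i.
rewrite (@integral_normal_rv _ _ _ _ _ (fun x => expR (t i 0 * x)) 0 1).
- have := @integral_std_normal_exp_quadratic R 0 (t i 0) ltr01.
  rewrite subr0 sqrtr1 invr1 mul1r mulr1 => <-.
  by apply: eq_integral => x _; rewrite !mul0r add0r.
- by apply: measurableT_comp => //; exact: measurable_funM.
- by move=> x; exact: expR_ge0.
- exact: geps.2.
Qed.

(* Each factor exp(<v, eps>^2 / 2) is written as the mean of exp(g <v, eps>)
   for an independent standard normal g, which keeps the exponent linear in one
   more direction; integrating g out updates the inverse N of 1 - sum v v^T by
   the Sherman-Morrison formula. *)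
Lemma gaussian_chaos_mgf (vs : seq 'cV[R]_n) (delta : R) : 0 < delta ->
  (forall x, \sum_(v <- vs) dot v x ^+ 2 <= (1 - delta) * dot x x) ->
  exists (N : 'M[R]_n) (D : R), [/\ N^T = N,
    N *m (1%:M - \sum_(v <- vs) v *m v^T) = 1%:M,
    0 <= D <= expR ((\sum_(v <- vs) dot v v) / (2 * delta)) &
    forall t, (\int[P]_w (expR (dot t (E w) +
                 (\sum_(v <- vs) dot v (E w) ^+ 2) / 2))%:E =
               (D * expR (dot t (N *m t) / 2))%:E)%E].
Proof.
move=> delta0; elim: vs => [|v vs IH] vsle.
  exists 1%:M, 1; split.
  - by rewrite trmx1.
  - by rewrite big_nil subr0 mulmx1.
  - by rewrite ler01 big_nil mul0r expR0 lexx.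
  - move=> t; rewrite mul1r mul1mx -gaussian_linear_mgf.
    by apply: eq_integral => w _; rewrite big_nil mul0r addr0.
have [x|N [D [NT NM /andP[D0 Dle] ND]]] := IH.
  by apply: le_trans (vsle x); rewrite big_cons lerDr sqr_ge0.
set M := \sum_(v <- vs) v *m v^T in NM.
(* Since [N] inverts 1 - M, the update by v is governed by the scalar a = <v, N v>: both the new
   inverse and the new constant involve 1 - a, whose positivity has to be drawn from [vsle]. *)
pose y := N *m v; pose a := dot v y.
have My : (1%:M - M) *m y = v by rewrite /y mulmxA (mulmx1C NM) mul1mx.
have yM : y^T *m (1%:M - M) = v^T by rewrite /y trmx_mul NT -mulmxA NM mulmx1.
have ay : a = dot y y - \sum_(u <- vs) dot u y ^+ 2.
  rewrite /a dotC -[in LHS]My mulmxBl mul1mx dotBr; congr (_ - _).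
  rewrite /M mulmx_suml /dot; under eq_bigr do rewrite summxE mulr_sumr.
  by rewrite exchange_big/=; apply: eq_bigr => u _; rewrite -/(dot _ _) dot_rank1 expr2.
(* The hypothesis is tested at x = y, where [ay] turns the sum over [vs] into |y|^2 - a. *)
have yle : delta * dot y y <= a - a ^+ 2.
  have := vsle y; rewrite big_cons -/a.
  set S := \sum_(j <- vs) _ in ay *; rewrite {}ay.
  set ay := dot v y; lra.
have a0 : 0 <= a - a ^+ 2.
  by apply: le_trans yle; rewrite mulr_ge0 ?dot_ge0// ltW.
have acs : delta * a ^+ 2 <= (a - a ^+ 2) * dot v v.
  have := dot_cauchy_schwarz v y; rewrite -/a => cs.
  apply: le_trans (ler_wpM2r (dot_ge0 v) yle).
  by rewrite -mulrA; apply: ler_wpM2l; [exact: ltW|rewrite [leRHS]mulrC].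
(* If a >= 1 then a - a^2 <= 0, so [a0] makes it 0, and [acs] contradicts a > 0. *)
have alt1 : a < 1.
  have [//|a1] := ltP a 1.
  have : a - a ^+ 2 <= 0.
    rewrite subr_le0 expr2 ler_pMr//; exact: lt_le_trans a1.
  move=> a2; have : a - a ^+ 2 = 0 by apply/eqP; rewrite eq_le a2 a0.
  move=> az; move: acs; rewrite az mul0r leNgt pmulr_rgt0// exprn_gt0//.
  exact: lt_le_trans a1.
have s0 : 0 < 1 - a by rewrite subr_gt0.
exists (N + (1 - a)^-1 *: (y *m y^T)), (D * (Num.sqrt (1 - a))^-1); split.
- by rewrite linearD/= linearZ/= trmx_mul trmxK NT.
- rewrite big_cons -/M.
  have -> : 1%:M - (v *m v^T + M) = (1%:M - M) - v *m v^T.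
    by rewrite opprD addrA addrAC.
  have yyvv : y *m y^T *m (v *m v^T) = a *: (y *m v^T).
    by rewrite mulmxA -(mulmxA y) dotE dotC -/a mul_mx_scalar -scalemxAl.
  rewrite mulmxDl -scalemxAl (mulmxBr N) NM (mulmxBr (y *m y^T)).
  rewrite -(mulmxA y y^T (1%:M - M)) yM yyvv.
  rewrite (mulmxA N) -/y.
  have -> : y *m v^T - a *: (y *m v^T) = (1 - a) *: (y *m v^T).
    by rewrite scalerBl scale1r.
  by rewrite scalerA mulVf ?gt_eqF// scale1r subrK.
(* For a > 0 this is [acs] divided by a. As 1 / (1 - a) = 1 + a / (1 - a) <= exp(a / (1 - a)), the
   new factor (1 - a)^(-1/2) costs at most exp(|v|^2 / (2 delta)). *)
- have avv : a / (1 - a) <= dot v v / delta.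
    rewrite ler_pdivrMr// mulrAC ler_pdivlMr// mulrC.
    have [a0'|a0'] := leP a 0.
      apply: (@le_trans _ _ 0); first by rewrite pmulr_rle0.
      by rewrite mulr_ge0 ?dot_ge0// ltW.
    rewrite -(ler_pM2l a0').
    have -> : a * (delta * a) = delta * a ^+ 2 by ring.
    by apply: (le_trans acs); rewrite le_eqVlt; apply/orP; left; apply/eqP; ring.
  rewrite mulr_ge0 ?invr_ge0 ?sqrtr_ge0//= big_cons mulrDl expRD [leRHS]mulrC.
  apply: ler_pM => //.
  have e0 := expR_gt0 (dot v v / (2 * delta)).
  rewrite -ler_sqr ?nnegrE ?invr_ge0 ?sqrtr_ge0 ?expR_ge0//.
  rewrite exprVn sqr_sqrtr ?(ltW s0)// -expRM_natl.
  have -> : (1 - a)^-1 = 1 + a / (1 - a) by field; rewrite gt_eqF.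
  have -> : 2%:R * (dot v v / (2 * delta)) = dot v v / delta.
    by field; rewrite gt_eqF.

  by apply: le_trans (expR_ge1Dx _) _; rewrite ler_expR.
- move=> t; pose f (wg : T * R) := expR (dot t (E wg.1) + wg.2 * dot v (E wg.1) +
    (\sum_(u <- vs) dot u (E wg.1) ^+ 2) / 2).
  have mE u : measurable_fun setT (fun wg : T * R => dot u (E wg.1)).
    apply: (measurableT_comp (measurable_dot_eps u)); exact: measurable_fst.
  have mf : measurable_fun setT (EFin \o f).
    apply/measurable_EFinP; apply: measurableT_comp => //.
    apply: measurable_funD; first apply: measurable_funD => //.
      by apply: measurable_funM => //; exact: measurable_snd.
    apply: measurable_funM => //; apply: measurable_sum => u.
    exact: measurable_funX.
  transitivity (\int[P]_w \int[normal_prob (0:R) (1:R)]_g (EFin \o f) (w, g))%E.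
    apply: eq_integral => w _; rewrite /f/=.
    set b := dot v (E w); set A := dot t (E w); set B := (\sum_(u <- vs) _) / 2.
    transitivity (\int[normal_prob (0:R) (1:R)]_g
        (expR (A + B) * expR (0 * g ^+ 2 / 2 + b * g))%:E)%E; last first.
      by apply: eq_integral => g _; rewrite -expRD; congr (expR _)%:E; ring.
    rewrite integral_std_normal_scale_exp_quadratic ?expR_ge0//.
    rewrite subr0 sqrtr1 invr1 mul1r mulr1 -expRD; congr (expR _)%:E.
    by rewrite big_cons -/b /B; ring.
  rewrite fubini_tonelli//; last by move=> wg; rewrite lee_fin expR_ge0.
  pose b := dot t y.
  (* For fixed g the inner integral is the induction hypothesis at t + g v; expanding the form of
     [N] there leaves a Gaussian integral in g with quadratic coefficient a < 1 and linear
     coefficient b = <t, N v>. *)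
  transitivity (\int[normal_prob (0:R) (1:R)]_g
     (D * expR (dot t (N *m t) / 2) * expR (a * g ^+ 2 / 2 + b * g))%:E)%E.
    apply: eq_integral => g _.
    transitivity (\int[P]_w (expR (dot (t + g *: v) (E w) +
        (\sum_(u <- vs) dot u (E w) ^+ 2) / 2))%:E)%E.
      by apply: eq_integral => w _; rewrite /f/= dotDl dotZl.
    rewrite ND; congr (_%:E); rewrite -[RHS]mulrA -expRD; congr (_ * expR _).
    have Nsym u z : dot u (N *m z) = dot (N *m u) z by rewrite dotMl NT.
    rewrite mulmxDr -scalemxAr -/y !(dotDl, dotDr, dotZl, dotZr).
    rewrite (Nsym v t) -/y (dotC y t) -/b -/a; by field.
  rewrite integral_std_normal_scale_exp_quadratic//; last first.
    by rewrite mulr_ge0 ?expR_ge0.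
  rewrite mulmxDl dotDr -scalemxAl dotZr dot_rank1 (dotC y) -/b mulrDl expRD.
  congr (_%:E).
  have -> : b ^+ 2 / (1 - a) / 2 = (1 - a)^-1 * (b * b) / 2 by ring.
  ring.
Qed.

End GaussianChaos.

(** * Spectral norm *)

Section SpectralNorm.
Context {R : realType} {n : nat}.
Implicit Types (x y : 'cV[R]_n) (A : 'M[R]_n).

Lemma normn_ge0 x : 0 <= normn x.
Proof. exact: sqrtr_ge0. Qed.

Lemma normnE x : normn x ^+ 2 = dot x x / n%:R.
Proof.
rewrite /normn sqr_sqrtr.
  by rewrite mulrC; congr (_ / _); apply: eq_bigr => i _; rewrite expr2.
by rewrite mulr_ge0 ?invr_ge0// sumr_ge0// => i _; rewrite sqr_ge0.
Qed.

(** This crude Frobenius bound shows that the set defining [spectral_norm] is bounded, so that its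
    [sup] is a genuine supremum. *)
Lemma dot_mulmx_frobenius A x :
  dot (A *m x) (A *m x) <= (\sum_i \sum_j A i j ^+ 2) * dot x x.
Proof.
rewrite [in leLHS]/dot mulr_suml; apply: ler_sum => i _.
have -> : (A *m x) i 0 = dot (row i A)^T x.
  by rewrite mxE; apply: eq_bigr => j _; rewrite !mxE.
rewrite -expr2; apply: le_trans (dot_cauchy_schwarz _ _) _.
rewrite le_eqVlt; apply/orP; left; apply/eqP; congr (_ * _).
by apply: eq_bigr => j _; rewrite !mxE expr2.
Qed.

Hypothesis n_gt0 : (0 < n)%N.

Let n0 : 0 < n%:R :> R. Proof. by rewrite ltr0n. Qed.

Lemma normn_gt0 x : x != 0 -> 0 < normn x.
Proof.
move=> x0; rewrite lt_neqAle normn_ge0 andbT eq_sym -sqrf_eq0 normnE.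
rewrite mulf_eq0 invr_eq0 (gt_eqF n0) orbF; apply: contra x0 => /eqP.
by move=> /dot_eq0 ->.
Qed.

Lemma spectral_norm_has_sup A :
  has_sup [set normn (A *m x) / normn x | x in [set x : 'cV[R]_n | x != 0]].
Proof.
split.
  pose e : 'cV[R]_n := const_mx 1.
  exists (normn (A *m e) / normn e), e => //=.
  apply/eqP => /matrixP /(_ (Ordinal n_gt0) 0); rewrite !mxE => /eqP.
  by rewrite oner_eq0.
exists (Num.sqrt (\sum_i \sum_j A i j ^+ 2)) => _ [x /= x0 <-].
have F0 : 0 <= \sum_i \sum_j A i j ^+ 2.
  by apply: sumr_ge0 => i _; apply: sumr_ge0 => j _; exact: sqr_ge0.
rewrite ler_pdivrMr ?normn_gt0//.
rewrite -ler_sqr ?nnegrE ?mulr_ge0 ?sqrtr_ge0 ?normn_ge0//.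
rewrite exprMn (sqr_sqrtr F0) !normnE mulrA ler_pM2r ?invr_gt0//.
exact: dot_mulmx_frobenius.
Qed.

Lemma spectral_norm_ge0 A : 0 <= spectral_norm A.
Proof.
have [[y [x x0 yE]] _] := spectral_norm_has_sup A.
apply: (@le_trans _ _ y); first by rewrite -yE divr_ge0 ?normn_ge0.
by apply: sup_upper_bound (spectral_norm_has_sup A) _ _; exists x.
Qed.

Lemma dot_mulmx_le A x :
  dot (A *m x) (A *m x) <= spectral_norm A ^+ 2 * dot x x.
Proof.
have [->|x0] := eqVneq x 0.
  by rewrite mulmx0 !dot0r mulr0.
rewrite -(@ler_pM2r _ n%:R^-1) ?invr_gt0// -mulrA -!normnE -exprMn.
rewrite ler_sqr ?nnegrE ?mulr_ge0 ?spectral_norm_ge0 ?normn_ge0//.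
rewrite -ler_pdivrMr ?normn_gt0//.
by apply: sup_upper_bound (spectral_norm_has_sup A) _ _; exists x.
Qed.

(** Duality: for w = A^T x one has |w|^2 = <x, A w>, and Cauchy-Schwarz reduces the claim to the
    bound on |A w|. *)
Lemma dot_trmx_mulmx_le A x :
  dot (A^T *m x) (A^T *m x) <= spectral_norm A ^+ 2 * dot x x.
Proof.
set w := A^T *m x; have [w0|w0] := eqVneq (dot w w) 0.
  by rewrite w0 mulr_ge0 ?sqr_ge0 ?dot_ge0.
have wgt0 : 0 < dot w w by rewrite lt_neqAle eq_sym w0 dot_ge0.
rewrite -(ler_pM2r wgt0) -expr2.
have {1}-> : dot w w = dot x (A *m w) by rewrite [in LHS]/w dotMl trmxK.
apply: le_trans (dot_cauchy_schwarz _ _) _.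
rewrite [leLHS]mulrC [leRHS]mulrAC ler_wpM2r ?dot_ge0//.
exact: dot_mulmx_le.
Qed.

End SpectralNorm.

(** * Orthogonal projections *)

Section OrthogonalProjection.
Context {R : realType} {n : nat}.
Implicit Types (x y z u : 'cV[R]_n) (p A B : 'M[R]_n).

Lemma mulmx_cV_inj A B : (forall x, A *m x = B *m x) -> A = B.
Proof.
move=> AB; apply/matrixP => i j.
by have /matrixP/(_ i 0) := AB (delta_mx j 0); rewrite -!colE !mxE.
Qed.

Lemma dot_inj x y : (forall z, dot z x = dot z y) -> x = y.
Proof.
move=> xy; apply/eqP; rewrite -subr_eq0; apply/eqP/dot_eq0.
by rewrite dotBr xy subrr.
Qed.

(** Orthogonality of x - p x to the subspace gives <p z, x> = <p z, p x>, from which both properties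
    are read off. Projections enter the later arguments through these two identities. *)
Lemma orthogonal_projection_idem (S : {vspace 'cV[R]_n}) p :
  is_orthogonal_projection S p -> p^T = p /\ p *m p = p.
Proof.
move=> pS; have po z x : dot (p *m z) x = dot (p *m z) (p *m x).
  have /matrixP/(_ 0 0) := (pS x).2 _ (pS z).1.
  by rewrite dotE dotBr !mxE eqxx mulr1n => /eqP; rewrite subr_eq0 => /eqP.
have pT : p^T = p.
  apply: mulmx_cV_inj => x; apply: dot_inj => z.
  by rewrite -dotMl po (dotC (p *m z)) -po dotC.
have dp z y : dot z (p *m y) = dot (p *m z) y by rewrite dotMl pT.
split=> //; apply: mulmx_cV_inj => x; apply: dot_inj => z.
by rewrite -mulmxA dp -po dp.
Qed.

Lemma dot_orthogonal_projection p x : p^T = p -> p *m p = p ->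
  dot (x - p *m x) (x - p *m x) = dot x x - dot (p *m x) (p *m x).
Proof.
move=> pT pp; have pxx : dot (p *m x) (p *m x) = dot (p *m x) x.
  by rewrite dotMl pT mulmxA pp dotC.
by rewrite !(dotBl, dotBr) (dotC x (p *m x)) pxx; ring.
Qed.

(** As p u = 0, <u, z> = <u, z - p z>, so its square is at most |z - p z|^2, which is what
    Pythagoras leaves beside |p z|^2. *)
Lemma bessel_projection p u z : p^T = p -> p *m p = p -> p *m u = 0 ->
  dot u u <= 1 -> dot (p *m z) (p *m z) + dot u z ^+ 2 <= dot z z.
Proof.
move=> pT pp pu u1; rewrite addrC -lerBrDr -dot_orthogonal_projection//.
have -> : dot u z = dot u (z - p *m z).
  by rewrite dotBr [dot u (p *m z)]dotC dotMl pT pu dot0r subr0.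
apply: le_trans (dot_cauchy_schwarz _ _) _.
by rewrite ler_piMl ?dot_ge0.
Qed.

End OrthogonalProjection.

(** * Exponential moment for one model *)

Section OneModel.
Context d (T : measurableType d) (R : realType) (P : probability T R).
Context (n : nat) (eps : 'I_n -> {RV P >-> R}).
Hypothesis geps : standard_gaussian eps.
Hypothesis n_gt0 : (0 < n)%N.
Variables (Pn p : 'M[R]_n) (u : 'cV[R]_n).
Hypotheses (pT : p^T = p) (pp : p *m p = p) (pu : p *m u = 0).
Hypothesis u1 : dot u u <= 1.

Let E w : 'cV[R]_n := \col_i eps i w.
Let rho2 := spectral_norm Pn ^+ 2.
Let tr := \tr (Pn^T *m p *m Pn).

(* With P = Pn, the form sum_(v <- vs w0 w1) <v, x>^2 is
   w0^2 |p P x|^2 + w1^2 <u, P x>^2. *)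
Let vs (w0 w1 : R) : seq 'cV[R]_n :=
  rcons [seq w0 *: ((p *m Pn)^T *m delta_mx i 0) | i <- enum 'I_n] (w1 *: (Pn^T *m u)).

Let sum_vs_sqr w0 w1 x : \sum_(v <- vs w0 w1) dot v x ^+ 2 =
  w0 ^+ 2 * dot (p *m (Pn *m x)) (p *m (Pn *m x)) + w1 ^+ 2 * dot u (Pn *m x) ^+ 2.
Proof.
rewrite /vs -cats1 big_cat big_seq1 big_map big_enum/=; congr (_ + _).
  rewrite [in RHS]/dot mulr_sumr; apply: eq_bigr => i _.
  rewrite dotZl exprMn expr2; congr (_ * _).
  rewrite dotMl trmxK mulmxA /dot (bigD1 i)//= big1 => [|j ji].
    by rewrite mxE !eqxx mul1r addr0 expr2.
  by rewrite mxE (negPf ji) mul0r.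
by rewrite dotZl exprMn dotMl trmxK.
Qed.

Let sum_vs_norm w0 w1 : \sum_(v <- vs w0 w1) dot v v =
  w0 ^+ 2 * tr + w1 ^+ 2 * dot (Pn^T *m u) (Pn^T *m u).
Proof.
rewrite /vs -cats1 big_cat big_seq1 big_map big_enum/=; congr (_ + _); last first.
  by rewrite dotZl dotZr mulrA expr2.
have -> : tr = \tr ((p *m Pn) *m (p *m Pn)^T).
  rewrite /tr mxtrace_mulC trmx_mul pT [in RHS]mulmxA [RHS]mxtrace_mulC !mulmxA pp.
  by rewrite -(mulmxA p) [RHS]mxtrace_mulC.
rewrite /mxtrace mulr_sumr; apply: eq_bigr => i _.
rewrite dotZl dotZr mulrA -expr2; congr (_ * _).
by rewrite mxE; apply: eq_bigr => j _; rewrite -!colE !mxE.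
Qed.

(** [gaussian_chaos_mgf] is applied to [vs w0 w1], normalised by h = b (1 + 1/alpha). By Bessel the
    form is at most b / h = 1 - delta with delta = 1 / (1 + alpha); division by delta then puts the
    factor 1 + alpha before the mean, where <u, P eps>^2 is charged rho^2. *)
Lemma one_model_exp_moment (kappa alpha b : R) :
  0 < kappa -> kappa < 1 -> 0 < alpha -> 0 < b -> rho2 / (1 - kappa) <= b ->
  (\int[P]_w (expR (((1 + kappa) * dot (p *m (Pn *m E w)) (p *m (Pn *m E w)) +
      dot u (Pn *m E w) ^+ 2 / (1 - kappa) -
      (1 + alpha) * ((1 + kappa) * tr + rho2 / (1 - kappa))) /
      (2 * b * (1 + alpha^-1))))%:E <= 1)%E.
Proof.
move=> k0 k1 a0 b0 rb.
have k1' : 0 < 1 - kappa by rewrite subr_gt0.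
have a1 : 0 < 1 + alpha^-1 by rewrite addr_gt0 ?invr_gt0.
pose h := b * (1 + alpha^-1); have h0 : 0 < h by rewrite mulr_gt0.
pose w0 := Num.sqrt ((1 + kappa) / h); pose w1 := Num.sqrt ((1 - kappa)^-1 / h).
have w02 : w0 ^+ 2 = (1 + kappa) / h.
  by rewrite sqr_sqrtr// divr_ge0 ?ltW// addr_gt0.
have w12 : w1 ^+ 2 = (1 - kappa)^-1 / h.
  by rewrite sqr_sqrtr// divr_ge0 ?ltW// invr_gt0.
pose delta := (1 + alpha)^-1.
have a1' : 0 < 1 + alpha by rewrite addr_gt0.
have d0 : 0 < delta by rewrite invr_gt0.
have kk : (1 + kappa) <= (1 - kappa)^-1.
  by rewrite -[leRHS]mul1r ler_pdivlMr//; nra.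
have := @gaussian_chaos_mgf _ _ _ _ _ _ geps (vs w0 w1) delta d0.
case=> [x|N [D [_ _ /andP[D0 Dle] /(_ 0) DN]]].
  rewrite sum_vs_sqr w02 w12.
  set X := dot (p *m _) _; set U := dot u _ ^+ 2.
  (* Both weights are raised to the larger one, 1 / (1 - kappa), so that Bessel applies to the
     sum. *)
  apply: (@le_trans _ _ ((1 - kappa)^-1 / h * (X + U))).
    rewrite mulrDr lerD2r ler_wpM2r ?dot_ge0// ler_wpM2r// invr_ge0; exact: ltW.
  apply: (@le_trans _ _ ((1 - kappa)^-1 / h * (rho2 * dot x x))).
    apply: ler_wpM2l; first by rewrite divr_ge0 ?ltW// invr_gt0.
    apply: le_trans (bessel_projection _ pT pp pu u1) _; exact: dot_mulmx_le.
  have -> : 1 - delta = b / h.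
    rewrite /delta /h; by field; rewrite !gt_eqF//= addrC.
  rewrite mulrA ler_wpM2r ?dot_ge0// mulrAC ler_wpM2r ?invr_ge0 ?(ltW h0)//.
  by rewrite mulrC.
pose c := (1 + alpha) * ((1 + kappa) * tr + rho2 / (1 - kappa)) / (2 * h).
under eq_integral => w _.
  rewrite (_ : _ / _ = - c + (dot 0 (E w) +
     (\sum_(v <- vs w0 w1) dot v (E w) ^+ 2) / 2)); last first.
    rewrite dot0l add0r sum_vs_sqr w02 w12 /c.
    rewrite -[2 * b * _]mulrA -/h.
    by field; rewrite !gt_eqF.
  rewrite expRD EFinM.
  over.
rewrite ge0_integralZl ?lee_fin ?expR_ge0//; last first.
  apply/measurable_EFinP; apply: measurableT_comp => //; apply: measurable_funD.
    exact: measurable_dot_eps.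
  apply: measurable_funM => //; apply: measurable_sum => v.
  by apply: measurable_funX; exact: measurable_dot_eps.
rewrite DN dot0l mul0r expR0 mulr1 -EFinM lee_fin.
rewrite expRN mulrC ler_pdivrMr ?expR_gt0// mul1r.
apply: (le_trans Dle); rewrite ler_expR sum_vs_norm w02 w12 /c /delta.
rewrite [leLHS](_ : _ = (1 + alpha) * ((1 + kappa) * tr +
   dot (Pn^T *m u) (Pn^T *m u) / (1 - kappa)) / (2 * h)); last first.
  by field; rewrite !gt_eqF.
apply: ler_wpM2r; first by rewrite invr_ge0 mulr_ge0// ltW.
apply: ler_wpM2l; first exact: ltW.
rewrite lerD2l; apply: ler_wpM2r; first by rewrite invr_ge0 ltW.
apply: le_trans (dot_trmx_mulmx_le n_gt0 _ _) _.
by rewrite ler_piMr ?sqr_ge0.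
Qed.

End OneModel.

(** * Counting models by dimension *)

Section CountingModels.
Context {R : realType} {n : nat} {M : countType}.
Variables (S : M -> {vspace 'cV[R]_n}) (A : R).
Hypothesis logS : log_nb_models_le S A.

Let D k := [set m | \dim (S m) = k].

Lemma finite_models_of_dim k : finite_set (D k).
Proof.
apply: contrapT => Dk.
have Doo : nb_models S k = +oo%E.
  by rewrite /nb_models /counting; case: asboolP.
by have := logS (k := k); rewrite Doo/= => /(_ (ltry 0)).
Qed.

Lemma card_models_of_dim k : (#|` fset_set (D k)|)%:R <= expR (A * k%:R).
Proof.
have NE : nb_models S k = ((#|` fset_set (D k)|)%:R)%:E :> \bar R.
  rewrite /nb_models /counting; case: asboolP => // /(_ _)[].
  exact: finite_models_of_dim.
have [->|N0] := eqVneq (#|` fset_set (D k)|)%:R (0 : R); first exact: expR_ge0.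
have Ngt0 : 0 < (#|` fset_set (D k)|)%:R :> R by rewrite lt_neqAle eq_sym N0 ler0n.
have := logS (k := k); rewrite NE lte_fin => /(_ Ngt0).
by rewrite lne_EFin// lee_fin -ler_expR lnK.
Qed.

(** Dimensions are at most n and each level is finite, so [M] is finite and listed by [r]. Level k
    holds at most exp(A k) models of weight exp(- (A + omega) k), which leaves a geometric sum of
    ratio exp(- omega). *)
Lemma models_exp_weight_sum (omega : R) : 0 < omega ->
  exists r : seq M, [/\ uniq r, (forall m, m \in r) &
    \sum_(m <- r) expR (- ((A + omega) * (\dim (S m))%:R)) <=
    (1 - expR (- omega))^-1].
Proof.
move=> w0.
have dim_le m : (\dim (S m) < n.+1)%N.
  by rewrite ltnS (leq_trans (dimvS (subvf _)))// dimvf /dim/= muln1.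
have finM : finite_set [set: M].
  apply: (@sub_finite_set _ _ (\bigcup_(k in `I_n.+1) D k)).
    by move=> m _; exists (\dim (S m)) => //=.
  by apply: bigcup_finite => // k _; exact: finite_models_of_dim.
exists (fset_set [set: M]); split; first exact: fset_uniq.
  by move=> m; rewrite in_fset_set// in_setT.
set q := expR (- omega).
have q1 : 0 < 1 - q by rewrite subr_gt0 -expR0 ltr_expR oppr_lt0.
rewrite (partition_big (fun m => Ordinal (dim_le m)) xpredT)//=.
apply: (@le_trans _ _ (\sum_(k < n.+1) q ^+ k)).
  apply: ler_sum => k _.
  rewrite (eq_bigr (fun=> expR (- ((A + omega) * k%:R)))) => [|m /eqP <-//].
  rewrite big_const_seq iter_addr_0 -size_filter.
  have szk : (size [seq m <- fset_set [set: M] | Ordinal (dim_le m) == k] <=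
      #|` fset_set (D k)|)%N.
    apply: uniq_leq_size; first by rewrite filter_uniq// fset_uniq.
    move=> m; rewrite mem_filter => /andP[/eqP mk _].
    rewrite in_fset_set; last exact: finite_models_of_dim.
    by apply/mem_set; rewrite /D/= -mk.
  apply: (@le_trans _ _ (expR (- ((A + omega) * k%:R)) * expR (A * k%:R))).

    rewrite -[leLHS]mulr_natr; apply: ler_wpM2l; first exact: expR_ge0.
    by apply: le_trans (card_models_of_dim k); rewrite ler_nat.
  rewrite -expRD /q -expRM_natl ler_expR le_eqVlt; apply/orP; left.
  by apply/eqP; ring.
rewrite -[leRHS]mul1r ler_pdivlMr// mulrC.
by rewrite -[leLHS]opprK -mulNr opprB -subrX1 opprB gerBl exprn_ge0 ?expR_ge0.
Qed.

End CountingModels.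

(** * Deterministic comparison of two criteria *)

Section PenalizedRisk.
Context {R : realType} {n : nat}.
Implicit Types (x y s xi : 'cV[R]_n) (p q : 'M[R]_n).

(** The vector u_m. It is 0 when the residual vanishes, hence a norm at most 1 rather than equal to
    1. *)
Definition unit_residual p s : 'cV[R]_n :=
  (Num.sqrt (dot (s - p *m s) (s - p *m s)))^-1 *: (s - p *m s).

Lemma unit_residualE p s :
  s - p *m s = Num.sqrt (dot (s - p *m s) (s - p *m s)) *: unit_residual p s.
Proof.
rewrite /unit_residual scalerA; set a := s - p *m s.
have [a0|a0] := eqVneq (dot a a) 0; first by rewrite (dot_eq0 a0) scaler0.
rewrite mulfV ?scale1r// gt_eqF// sqrtr_gt0.
by rewrite lt_neqAle eq_sym a0 dot_ge0.
Qed.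

Lemma unit_residual_le1 p s : dot (unit_residual p s) (unit_residual p s) <= 1.
Proof.
rewrite /unit_residual dotZl dotZr mulrA -invfM -expr2 sqr_sqrtr ?dot_ge0//.
have [->|a0] := eqVneq (dot (s - p *m s) (s - p *m s)) 0; first by rewrite mulr0.
by rewrite mulVf.
Qed.

Lemma mulmx_unit_residual p s : p *m p = p -> p *m unit_residual p s = 0.
Proof. by move=> pp; rewrite -scalemxAr mulmxBr mulmxA pp subrr scaler0. Qed.

Lemma dot_residual_observation p s xi : p^T = p -> p *m p = p ->
  dot (s + xi - p *m (s + xi)) (s + xi - p *m (s + xi)) =
  dot (s - p *m s) (s - p *m s) + 2 * dot (s - p *m s) xi + dot xi xi -
  dot (p *m xi) (p *m xi).
Proof.
move=> pT pp; rewrite dot_orthogonal_projection// dot_orthogonal_projection//.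
have sy x y : dot x (p *m y) = dot (p *m x) y by rewrite dotMl pT.
rewrite mulmxDr !(dotBl, dotDl, dotDr) (dotC xi s) (dotC (p *m xi) (p *m s)).
by rewrite (sy (p *m s) xi) mulmxA pp dotNl; ring.
Qed.

Lemma dot_estimation_error p s xi : p^T = p -> p *m p = p ->
  dot (s - p *m (s + xi)) (s - p *m (s + xi)) =
  dot (s - p *m s) (s - p *m s) + dot (p *m xi) (p *m xi).
Proof.
move=> pT pp; rewrite mulmxDr opprD addrA.
have o : dot (s - p *m s) (p *m xi) = 0.
  by rewrite -[X in X *m xi]pT -dotMl mulmxBr mulmxA pp subrr dot0l.
by rewrite (dotBl _ (p *m xi)) (dotBr _ (p *m xi) (s - _)) (dotBr _ (p *m xi) (p *m xi))
  (dotC (p *m xi) (s - _)) o; ring.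
Qed.

(** The energy Z_m as a function of a deterministic noise vector. *)
Definition noise_energy (kappa : R) p s xi : R :=
  (1 + kappa) * dot (p *m xi) (p *m xi) +
  dot (unit_residual p s) xi ^+ 2 / (1 - kappa).

(** The term |xi|^2 common to both criteria cancels. The cross term at [p] is absorbed by completing
    a square with the share 1 - kappa of its bias, which leaves the share kappa on the left; the
    cross term at [q] is bounded by the bias of [q] plus <u, xi>^2. *)
Lemma penalized_risk_le (kappa penp penq : R) p q s xi :
  0 < kappa -> kappa < 1 ->
  p^T = p -> p *m p = p -> q^T = q -> q *m q = q ->
  dot (s + xi - p *m (s + xi)) (s + xi - p *m (s + xi)) + penp <=
  dot (s + xi - q *m (s + xi)) (s + xi - q *m (s + xi)) + penq ->
  kappa * dot (s - p *m (s + xi)) (s - p *m (s + xi)) <=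
  2 * dot (s - q *m s) (s - q *m s) + penq + noise_energy kappa q s xi +
  (noise_energy kappa p s xi - penp).
Proof.
move=> k0 k1 pT pp qT qq.
rewrite !dot_residual_observation// dot_estimation_error// /noise_energy.
have res r : exists2 R0, R0 ^+ 2 = dot (s - r *m s) (s - r *m s) &
    dot (s - r *m s) xi = R0 * dot (unit_residual r s) xi.
  exists (Num.sqrt (dot (s - r *m s) (s - r *m s))).
    by rewrite sqr_sqrtr// dot_ge0.
  by rewrite [in LHS]unit_residualE dotZl.
have [R0 R0E ->] := res p; have [Q0 Q0E ->] := res q.
rewrite -R0E -Q0E.
have := dot_ge0 (p *m xi); have := dot_ge0 (q *m xi).
set E := dot (q *m xi) _; set e := dot (p *m xi) _.
set X := dot xi xi; set b := dot _ xi; set B := dot _ xi => E0 e0.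
have k1' : 0 < 1 - kappa by rewrite subr_gt0.
have bsq : 0 <= (1 - kappa) * R0 ^+ 2 + 2 * (R0 * b) + b ^+ 2 / (1 - kappa).
  have -> : (1 - kappa) * R0 ^+ 2 + 2 * (R0 * b) + b ^+ 2 / (1 - kappa) =
      ((1 - kappa) * R0 + b) ^+ 2 / (1 - kappa) by field; rewrite gt_eqF.
  by rewrite divr_ge0 ?sqr_ge0 ?ltW.
have Bsq : B ^+ 2 <= B ^+ 2 / (1 - kappa).
  rewrite ler_pdivlMr// ler_piMr ?sqr_ge0//.
  by rewrite lerBlDr lerDl ltW.
have QB := sqr_ge0 (Q0 - B).
have kE : 0 <= kappa * E by rewrite mulr_ge0// ltW.
move: bsq Bsq; set b2 := b ^+ 2 / _; set B2 := B ^+ 2 / _ => bsq Bsq.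
nra.
Qed.

End PenalizedRisk.

(** * Monotonicity and affine bounds for integrals *)

Section LowerIntegral.
Local Open Scope ereal_scope.
Context d (T : measurableType d) (R : realType) (mu : {measure set T -> \bar R}).

(* The integral of a nonnegative function is the supremum of the integrals of
   the simple functions below it, so that no measurability is needed. *)
Lemma integral_mono_nonmeasurable (f g : T -> \bar R) :
  (forall x, 0 <= f x) -> (forall x, f x <= g x) ->
  \int[mu]_x f x <= \int[mu]_x g x.
Proof.
move=> f0 fg; have g0 x : 0 <= g x by exact: le_trans (fg x).
rewrite !ge0_integralTE//; apply: le_ereal_sup => _ [h hf <-].
by exists h => // x; apply: le_trans (fg x).
Qed.

Lemma integral_affine_le (P : probability T R) (W : T -> R) (a b w : R) :
  (0 <= a)%R -> (0 <= b)%R -> (forall x, 0 <= W x)%R ->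
  measurable_fun setT W -> \int[P]_x (W x)%:E <= w%:E ->
  \int[P]_x (a + b * W x)%:E <= (a + b * w)%:E.
Proof.
move=> a0 b0 W0 mW Ww; under eq_integral do rewrite EFinD.
have mbW : measurable_fun setT (fun x => (b * W x)%:E).
  by apply/measurable_EFinP; exact: measurable_funM.
rewrite ge0_integralD//; last by move=> x _; rewrite lee_fin mulr_ge0.
rewrite integral_cst//= probability_setT mule1 EFinD leeD2l//.
under eq_integral do rewrite EFinM.
rewrite ge0_integralZl ?lee_fin//.
- by rewrite EFinM lee_wpmul2l ?lee_fin.
- exact/measurable_EFinP.
- by move=> x _; rewrite lee_fin.
Qed.

End LowerIntegral.

(** * Assembly of the risk bound *)

Lemma measurable_mulmx_eps d (T : measurableType d) (R : realType)
    (P : probability T R) (n : nat) (eps : 'I_n -> {RV P >-> R})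
    (B : 'M[R]_n) (i : 'I_n) :
  measurable_fun setT (fun w => (B *m \col_j eps j w) i 0).
Proof.
under eq_fun do rewrite mxE; apply: measurable_sum => j.
by under eq_fun do rewrite mxE; exact: measurable_funM.
Qed.

Lemma noise_energyZ (R : realType) (n : nat) (kappa a : R) (p : 'M[R]_n)
    (s xi : 'cV[R]_n) :
  noise_energy kappa p s (a *: xi) = a ^+ 2 * noise_energy kappa p s xi.
Proof. by rewrite /noise_energy -scalemxAr !(dotZl, dotZr); ring. Qed.

Theorem corollary2p1 (R : realType) (theta omega c : R)
    (theta_gt0 : 0 < theta) (omega_gt0 : 0 < omega)
    (c_gt0 : 0 < c) (c_lt1 : c < 1) :
  exists C : R, 1 < C /\
  forall (n : nat) (Pn : 'M[R]_n)
    (M : countType) (S : M -> {vspace 'cV[R]_n}) (proj : M -> 'M[R]_n)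
    (s : 'cV[R]_n) (sigma A L : R)
    (d : measure_display) (T : measurableType d) (P : probability T R)
    (eps : 'I_n -> {RV P >-> R}) (mhat : T -> M),
  let tr m := \tr (Pn^T *m proj m *m Pn) in
  let pen m := (1 + theta + L) * (tr m / n%:R) * sigma ^+ 2 in
  let Y := observation s sigma Pn eps in
  let stilde w := proj (mhat w) *m Y w in
  (0 < n)%N ->
  (forall m, (S m <= matrix_image Pn)%VS) ->
  (forall m, is_orthogonal_projection (S m) (proj m)) ->
  s \in matrix_image Pn ->
  0 < sigma ->
  standard_gaussian eps ->
  (forall m, c * spectral_norm Pn ^+ 2 * (\dim (S m))%:R <= tr m) ->
  0 <= A ->
  log_nb_models_le S A ->
  0 < L ->
  2 * (1 + theta) ^+ 3 / (c * theta ^+ 2) * (A + omega) <= L ->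
  (forall w, is_minimizer (penalized_criterion proj pen (Y w)) (mhat w)) ->
  ('E_P[fun w => (normn (s - stilde w) ^+ 2)%R] <=
   (C * inf [set normn (s - proj m *m s) ^+ 2 +
                 Num.max L 1 *
                 (Num.max (tr m) (c * spectral_norm Pn ^+ 2) / n%:R) *
                 sigma ^+ 2 | m in [set: M]])%R%:E)%E.
Proof.
(* These make (1 + alpha) (1 + kappa) = 1 + theta while
   2 (1 + 1/alpha) / (1 - kappa) <= K, the constant in the hypothesis on L. *)
pose kappa := theta / (2 + theta); pose alpha := theta / 2.
pose K := 2 * (1 + theta) ^+ 3 / theta ^+ 2.
(* c' = (1 + alpha) / (1 - kappa) is the multiple of rho^2 charged to the direction u_m; [We] is the
   bound of [models_exp_weight_sum]. *)
pose c' := (2 + theta) ^+ 2 / 4.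
pose We := (1 - expR (- omega))^-1.
have th2 : 0 < 2 + theta by rewrite addr_gt0.
have k0 : 0 < kappa by rewrite divr_gt0.
have k1 : kappa < 1 by rewrite ltr_pdivrMr// mul1r ltrDr.
have K0 : 0 < K by rewrite divr_gt0 ?mulr_gt0 ?exprn_gt0 ?addr_gt0.
have c'0 : 0 < c' by rewrite divr_gt0 ?exprn_gt0.
have We0 : 0 < We by rewrite invr_gt0 subr_gt0 -expR0 ltr_expR oppr_lt0.
(* The three summands pay for the bias, for the penalty and for the margin rho^2 (c' + K W); the
   last has 1 / c because the target contains c rho^2. *)
pose C := kappa^-1 * (2 + 2 * (2 + theta) + 2 * (c' + K * We) / c).
have h : 0 < 2 * (c' + K * We) / c.
  by rewrite divr_gt0// mulr_gt0// addr_gt0// mulr_gt0.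
exists C; split.
  rewrite /C mulrC ltr_pdivlMr// mul1r; apply: (lt_trans k1).
  by rewrite -addrA ltr_wpDr ?ltr1n// addr_ge0 ?ltW// mulr_gt0.
have C0 : 0 < C.
  by rewrite mulr_gt0 ?invr_gt0// addr_gt0// addr_gt0// mulr_gt0.
move=> n Pn M S proj s sigma A L d T P eps mhat tr pen Y stilde.
move=> n0 Sim oproj sim sigma0 geps trS A0 logS L0 LA mhat_min.
have nR0 : 0 < n%:R :> R by rewrite ltr0n.
set rho2 := spectral_norm Pn ^+ 2.
have rho20 : 0 <= rho2 by exact: sqr_ge0.
have tr0 m : 0 <= tr m.
  by apply: le_trans (trS m); rewrite mulr_ge0 ?ler0n// mulr_ge0// ltW.
pose x m := normn (s - proj m *m s) ^+ 2 +
  Num.max L 1 * (Num.max (tr m) (c * rho2) / n%:R) * sigma ^+ 2.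
have L1 : 1 <= Num.max L 1 by rewrite le_max lexx orbT.
have x0 m : 0 <= x m.
  rewrite addr_ge0 ?sqr_ge0// mulr_ge0 ?sqr_ge0//.
  apply: mulr_ge0; first exact: le_trans L1.
  by rewrite divr_ge0 ?ler0n// le_max tr0.
have E0 : (0 <= 'E_P[fun w => (normn (s - stilde w) ^+ 2)%R])%E.
  by rewrite unlock; apply: integral_ge0 => w _; rewrite lee_fin sqr_ge0.
(* Each model is treated separately. A space carrying a probability is nonempty, so [mhat] yields a
   model and the infimum runs over a nonempty set. *)
suff Ex m : ('E_P[fun w => (normn (s - stilde w) ^+ 2)%R] <= (C * x m)%:E)%E.
  have [w _] : [set: T] !=set0.
    apply/set0P/eqP => T0; have := probability_setT P.
    by rewrite T0 measure0 => /eqP; rewrite eqe eq_sym oner_eq0.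
  move: E0 Ex; move: ('E_P[_])%E => [e||//] E0 Ex; last by have := Ex (mhat w).
  rewrite lee_fin mulrC -ler_pdivrMr//.
  apply: lb_le_inf; first by exists (x (mhat w)), (mhat w).
  move=> _ [m _ <-]; rewrite ler_pdivrMr// mulrC -lee_fin.
  exact: Ex.
(* The scaling by K rho^2 below requires rho > 0. If rho = 0 then [Pn] vanishes, s = 0 and the loss
   is 0. *)
have [rz|rnz] := eqVneq rho2 0.
  have Pnz (y : 'cV[R]_n) : Pn *m y = 0.
    apply: dot_eq0; apply/eqP; rewrite eq_le dot_ge0 andbT.
    by apply: le_trans (dot_mulmx_le n0 _ _) _; rewrite -/rho2 rz mul0r.
  have sz : s = 0.
    by have /memv_imgP[y _ ->] := sim; rewrite lfunE/= Pnz.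
  rewrite unlock integral0_eq => [|w _]; first by rewrite lee_fin mulr_ge0// ltW.
  rewrite /stilde /Y /observation Pnz sz scaler0 addr0 mulmx0 subr0.
  by rewrite normnE dot0l mul0r.
have rho0 : 0 < rho2 by rewrite lt_neqAle eq_sym rnz.
have pT k := (orthogonal_projection_idem (oproj k)).1.
have pp k := (orthogonal_projection_idem (oproj k)).2.
have [r [_ rM rsum]] := models_exp_weight_sum logS omega_gt0.
pose Z k w := noise_energy kappa (proj k) s (Pn *m \col_i eps i w).
(* The excess of Z_k over its inflated mean, in units of K rho^2, shifted by the exponent that makes
   the models summable. *)
pose V k w := (Z k w - (1 + theta) * tr k - c' * rho2) / (K * rho2) -
  (A + omega) * (\dim (S k))%:R.
pose W w := \sum_(k <- r) expR (V k w).
have W0 w : 0 <= W w by apply: sumr_ge0 => k _; exact: expR_ge0.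
have mZ k : measurable_fun setT (Z k).
  rewrite /Z /noise_energy.
  apply: measurable_funD; apply: measurable_funM => //.
    apply: measurable_sum => i; under eq_fun do rewrite mulmxA.
    by apply: measurable_funM; exact: measurable_mulmx_eps.
  apply: measurable_funX; apply: measurable_sum => i.
  by apply: measurable_funM => //; exact: measurable_mulmx_eps.
have mV k : measurable_fun setT (fun w => expR (V k w)).
  apply: measurableT_comp => //; apply: measurable_funB => //.
  by apply: measurable_funM => //; do 2 apply: measurable_funB => //.
have mW : measurable_fun setT W by exact: measurable_sum.
have alpha0 : 0 < alpha by rewrite divr_gt0.
(* This value of b turns the scale of [one_model_exp_moment] into K rho^2. Its admissibility, [rb]
   below, amounts to theta (2 + theta)^2 <= 2 (1 + theta)^3. *)
have KE : 2 * (rho2 * (1 + theta) ^+ 3 / (theta * (2 + theta))) * (1 + alpha^-1) =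
    K * rho2.
  by rewrite /K /alpha; field; rewrite !gt_eqF.
have Vmoment k : (\int[P]_w (expR (V k w))%:E <=
    (expR (- ((A + omega) * (\dim (S k))%:R)))%:E)%E.
  have b0 : 0 < rho2 * (1 + theta) ^+ 3 / (theta * (2 + theta)).
    by rewrite divr_gt0// mulr_gt0// exprn_gt0// addr_gt0.
  have rb : rho2 / (1 - kappa) <= rho2 * (1 + theta) ^+ 3 / (theta * (2 + theta)).
    have -> : 1 - kappa = 2 / (2 + theta) by rewrite /kappa; field; rewrite gt_eqF.
    rewrite invf_div -mulrA; apply: ler_wpM2l => //.
    rewrite ler_pdivlMr ?mulr_gt0// mulrAC ler_pdivrMr//.
    rewrite -subr_ge0 (_ : _ - _ = 2 + 2 * theta + 2 * theta ^+ 2 + theta ^+ 3).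
      by rewrite !addr_ge0 ?mulr_ge0 ?exprn_ge0 ?(ltW theta_gt0).
    by ring.
  have := one_model_exp_moment geps n0 (pT k) (pp k)
    (mulmx_unit_residual s (pp k)) (unit_residual_le1 (proj k) s) k0 k1 alpha0 b0 rb.
  rewrite KE => moment.
  apply: (@le_trans _ _ (\int[P]_w ((expR (- ((A + omega) * (\dim (S k))%:R)))%:E *
    (expR ((Z k w - (1 + theta) * tr k - c' * rho2) / (K * rho2)))%:E)%E)%E).
    rewrite le_eqVlt; apply/orP; left; apply/eqP; apply: eq_integral => w _.
    by rewrite -EFinM -expRD addrC.
  rewrite ge0_integralZl ?lee_fin ?expR_ge0//; last first.
    apply/measurable_EFinP; apply: measurableT_comp => //.
    by apply: measurable_funM => //; do 2 apply: measurable_funB => //.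
  rewrite -[leRHS]mule1; apply: lee_wpmul2l; first by rewrite lee_fin expR_ge0.
  apply: le_trans moment; rewrite le_eqVlt; apply/orP; left; apply/eqP.
  apply: eq_integral => w _; congr (expR (_ / _))%:E.
  rewrite /Z /noise_energy -/tr -/rho2 /c' -!addrA; congr (_ + (_ + _)).
  rewrite -/(tr k) /alpha /kappa; field.
  by rewrite addrK gt_eqF//= pnatr_eq0.
have EW : (\int[P]_w (W w)%:E <= We%:E)%E.
  rewrite /W; under eq_integral do rewrite -sumEFin.
  rewrite ge0_integral_sum//; last by move=> k; apply/measurable_EFinP.
  apply: (@le_trans _ _ (\sum_(k <- r)
      (expR (- ((A + omega) * (\dim (S k))%:R)))%:E)%E); first exact: lee_sum.
  by rewrite sumEFin lee_fin.
(* As V k w <= exp(V k w) <= W w, a single random variable controls all models at once, including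
   the data-dependent [mhat w]. *)
have ZW k w : sigma ^+ 2 * Z k w <=
    n%:R * pen k + sigma ^+ 2 * (rho2 * (c' + K * W w)).
  have VW : V k w <= W w.
    apply: (@le_trans _ _ (expR (V k w))).
      by apply: le_trans (expR_ge1Dx _); rewrite lerDr.
    rewrite /W (big_rem k)//= lerDl.
    by apply: sumr_ge0 => j _; exact: expR_ge0.
  have Kr : 0 < K * rho2 by rewrite mulr_gt0.
  move: VW; rewrite /V lerBlDr ler_pdivrMr// => VW.
  (* The summability exponent is paid by the L part of the penalty: K (A + omega) / c <= L, and c
     rho^2 dim S_k <= tr k. *)
  have Ltr : (A + omega) * (\dim (S k))%:R * (K * rho2) <= L * tr k.
    have -> : (A + omega) * (\dim (S k))%:R * (K * rho2) =
        (2 * (1 + theta) ^+ 3 / (c * theta ^+ 2) * (A + omega)) *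
        (c * rho2 * (\dim (S k))%:R).
      by rewrite /K; field; rewrite !gt_eqF.
    apply: ler_pM => //.
    - by rewrite mulr_ge0 ?addr_ge0 ?divr_ge0 ?mulr_ge0 ?exprn_ge0 ?addr_ge0// ltW.
    - by rewrite mulr_ge0 ?ler0n// mulr_ge0// ltW.
  have -> : n%:R * pen k = sigma ^+ 2 * ((1 + theta + L) * tr k).
    by rewrite /pen; field; rewrite gt_eqF.
  rewrite -mulrDr; apply: ler_wpM2l; first exact: sqr_ge0.
  lra.
(* At the selected model [ZW] cancels the penalty; at m it adds a second copy of [pen m]. Each use
   leaves one margin, hence the factors 2. *)
have path w : normn (s - stilde w) ^+ 2 <=
    kappa^-1 * (2 * normn (s - proj m *m s) ^+ 2 + 2 * pen m +
      2 * sigma ^+ 2 * rho2 / n%:R * c') +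
    kappa^-1 * (2 * sigma ^+ 2 * rho2 / n%:R * K) * W w.
  set xi := Pn *m \col_i eps i w.
  have crit := mhat_min w m; rewrite /penalized_criterion !normnE in crit.
  have := @penalized_risk_le R n kappa (n%:R * pen (mhat w)) (n%:R * pen m)
    (proj (mhat w)) (proj m) s (sigma *: xi) k0 k1 (pT _) (pp _) (pT _) (pp _).
  rewrite -/(observation s sigma Pn eps w) -/(Y w) -/(stilde w).
  rewrite !noise_energyZ -/(Z m w) -/(Z (mhat w) w).
  have ZWm := ZW m w; have ZWh := ZW (mhat w) w.
  rewrite !normnE; set N := dot (s - stilde w) _; set a := dot (s - _) _.
  set G1 := sigma ^+ 2 * Z m w in ZWm *; set G2 := sigma ^+ 2 * Z (mhat w) w in ZWh *.
  move=> risk; have {}risk : kappa * N <= 2 * a + 2 * (n%:R * pen m) +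
      2 * (sigma ^+ 2 * (rho2 * (c' + K * W w))).
    have : kappa * N <= 2 * a + n%:R * pen m + G1 + (G2 - n%:R * pen (mhat w)).
      apply: risk; move: crit; rewrite -(ler_pM2l nR0) !mulrDr.
      by rewrite !(mulrC n%:R (_ / _)) !divfK ?gt_eqF.
    lra.
  have -> : kappa^-1 * (2 * (a / n%:R) + 2 * pen m + 2 * sigma ^+ 2 * rho2 / n%:R * c') +
      kappa^-1 * (2 * sigma ^+ 2 * rho2 / n%:R * K) * W w =
      (2 * a + 2 * (n%:R * pen m) + 2 * (sigma ^+ 2 * (rho2 * (c' + K * W w)))) /
      kappa / n%:R.
    by field; rewrite !gt_eqF.
  rewrite ler_pM2r ?invr_gt0// ler_pdivlMr// mulrC.
  exact: risk.
(* [mhat] is an arbitrary selection, so the loss is first dominated pointwise; the bound is affine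
   in the measurable [W] and its integral is computable. *)
rewrite unlock; apply: (@le_trans _ _ (\int[P]_w
  (kappa^-1 * (2 * normn (s - proj m *m s) ^+ 2 + 2 * pen m +
      2 * sigma ^+ 2 * rho2 / n%:R * c') +
    kappa^-1 * (2 * sigma ^+ 2 * rho2 / n%:R * K) * W w)%:E)%E).
  apply: integral_mono_nonmeasurable => w; first by rewrite lee_fin sqr_ge0.
  by rewrite lee_fin path.
have pen0 : 0 <= pen m.
  by rewrite /pen mulr_ge0 ?sqr_ge0// mulr_ge0 ?divr_ge0 ?addr_ge0 ?ler0n// ltW.
have sr0 : 0 <= 2 * sigma ^+ 2 * rho2 / n%:R.
  by rewrite divr_ge0 ?ler0n// mulr_ge0// mulr_ge0 ?sqr_ge0.
apply: le_trans (integral_affine_le _ _ _ _ EW) _ => //.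
- apply: mulr_ge0; first by rewrite invr_ge0 ltW.
  apply: addr_ge0; last by rewrite mulr_ge0// ltW.
  by apply: addr_ge0; rewrite mulr_ge0 ?sqr_ge0.
- apply: mulr_ge0; first by rewrite invr_ge0 ltW.
  by rewrite mulr_ge0// ltW.
rewrite lee_fin.
pose G := Num.max L 1 * (Num.max (tr m) (c * rho2) / n%:R) * sigma ^+ 2.
have mx0 : 0 <= Num.max (tr m) (c * rho2) by rewrite le_max tr0.
have Lm0 : 0 <= Num.max L 1 by exact: le_trans L1.
(* Here 1 + theta + L <= (2 + theta) max(L, 1), since the maximum dominates both 1 and L. *)
have penG : pen m <= (2 + theta) * G.
  have -> : pen m = (1 + theta + L) * tr m * (sigma ^+ 2 / n%:R).
    by rewrite /pen; ring.
  have -> : (2 + theta) * G = (2 + theta) * Num.max L 1 *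
      Num.max (tr m) (c * rho2) * (sigma ^+ 2 / n%:R) by rewrite /G; ring.
  apply: ler_wpM2r; first by rewrite divr_ge0 ?sqr_ge0 ?ler0n.
  apply: ler_pM => //; first by rewrite !addr_ge0 ?ltW.
    have : L <= Num.max L 1 by rewrite le_max lexx.
    have : 0 <= theta * (Num.max L 1 - 1) by rewrite mulr_ge0 ?subr_ge0// ltW.
    move: L1; set Lm := Num.max L 1; nra.
  by rewrite le_max lexx.
(* The entry c rho^2 of the maximum absorbs the margin, even for models of zero trace. *)
have rhoG : sigma ^+ 2 * rho2 / n%:R <= G / c.
  rewrite ler_pdivlMr//.
  have -> : sigma ^+ 2 * rho2 / n%:R * c = 1 * ((c * rho2) / n%:R) * sigma ^+ 2.
    by ring.
  rewrite /G; apply: ler_wpM2r; first exact: sqr_ge0.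
  apply: ler_pM => //; first by apply: divr_ge0; rewrite ?ler0n// mulr_ge0// ltW.
  apply: ler_wpM2r; first by rewrite invr_ge0 ltW.
  by rewrite le_max lexx orbT.
have G0 : 0 <= G by rewrite /G mulr_ge0 ?sqr_ge0// mulr_ge0// divr_ge0 ?ler0n.
rewrite /x -/G /C; set a := normn _ ^+ 2.
have a0 : 0 <= a by exact: sqr_ge0.
rewrite -[X in _ + X <= _]mulrA -mulrDr -[leRHS]mulrA; apply: ler_wpM2l.
  by rewrite invr_ge0 ltW.
have cK : 0 <= c' + K * We by rewrite ltW// addr_gt0// mulr_gt0.
have h1 : 2 * (c' + K * We) * (sigma ^+ 2 * rho2 / n%:R) <=
    2 * (c' + K * We) * (G / c).
  by apply: ler_wpM2l => //; rewrite mulr_ge0.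
(* Slack: the bias needs the coefficient 2, while the common factor multiplies all of a + G. *)
have h2 : 0 <= a * (2 * (2 + theta) + 2 * (c' + K * We) / c).
  by rewrite mulr_ge0// addr_ge0 ?(ltW h)// mulr_ge0// ltW.
have -> : 2 * a + 2 * pen m + 2 * sigma ^+ 2 * rho2 / n%:R * c' +
    2 * sigma ^+ 2 * rho2 / n%:R * K * We =
    2 * a + 2 * pen m + 2 * (c' + K * We) * (sigma ^+ 2 * rho2 / n%:R) by ring.
have -> : (2 + 2 * (2 + theta) + 2 * (c' + K * We) / c) * (a + G) =
    2 * a + 2 * G + 2 * ((2 + theta) * G) + 2 * (c' + K * We) * (G / c) +
    a * (2 * (2 + theta) + 2 * (c' + K * We) / c) by ring.
lra.
Qed.
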